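(* Let $a_1,a_2,a_3$ and $\eta$ be given real numbers. Then the Dirichlet problem on the Sierpinski gasket $SG$ $$\begin{cases}u(q_i)=a_i,& i=1,2,3,\\ \Delta u(x)=\eta,& x\in SG\setminus V_0,\end{cases}$$ has a unique solution $u$, and this solution is the fractal interpolation function on $SG$ with uniform vertical scaling factor $d=\frac15$ satisfying $u(q_i)=a_i$, $i=1,2,3$, and $$u(q_{ij})=\frac15\left(2a_i+2a_j+a_{6-i-j}-\frac{\eta}{3}\right)$$ for all distinct $i,j\in\{1,2,3\}$.
   Context: Sierpinski gasket. Let $q_1,q_2,q_3\in\mathbb{R}^2$ be the vertices of an equilateral triangle, $P_i(x)=\frac12(x+q_i)$ for $i=1,2,3$, and $SG$ the unique nonempty compact set with $SG=\bigcup_{i=1}^3P_i(SG)$. For a word $\omega=\omega_1\cdots\omega_m$ with letters in $\{1,2,3\}$ put $P_\omega=P_{\omega_1}\circ\cdots\circ P_{\omega_m}$ (identity for the empty word); $q_{ij}=P_i(q_j)$, so $q_{ii}=q_i$ and $q_{ij}=q_{ji}$. Let $V_0=\{q_1,q_2,q_3\}$, $V_m=\bigcup_{|\omega|=m}P_\omega(V_0)$, $V_*=\bigcup_{m\ge1}V_m$. For $m\ge 0$ and distinct $x,y\in V_m$, write $x\sim_my$ if there is a word $\omega$ of length $m$ with $x,y\in P_\omega(V_0)$. Harmonic functions. Let $\mathcal{E}_m(u)=\left(\frac53\right)^m\sum_{x\sim_my}(u(x)-u(y))^2$ (sum over unordered edges). A function $h$ on $SG$ is harmonic if $\mathcal{E}_{m-1}(h)=\mathcal{E}_m(h)$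 for all $m\ge1$. FIF with uniform vertical scaling factor. For any $B:V_1\to\mathbb{R}$ and $d\in(-1,1)$ there is a unique continuous $f:SG\to\mathbb{R}$ with $f|_{V_1}=B$ and $f(P_i(x))=d\,f(x)+h_i(x)$ for all $x\in SG$, $i=1,2,3$, where each $h_i$ is a harmonic function on $SG$. Such $f$ is called a fractal interpolation function (FIF) on $SG$ with uniform vertical scaling factor $d$; it is determined by $d$ and its values on $V_1$. Laplacian. For continuous $u$ on $SG$ and $m\ge1$, $\Delta_mu(x)=\sum_{y\sim_mx}(u(y)-u(x))$ for $x\in V_m\setminus V_0$. For a continuous function $g$ on $SG$, one says $u\in\mathrm{dom}\,\Delta$ with $\Delta u=g$ if $\frac325^m\Delta_mu(x)$ converges to $g$ uniformly on $V_*\setminus V_0$ as $m\to\infty$ (the expression being defined at $x\in V_m\setminus V_0$; i.e. $\sup_{x\in V_m\setminus V_0}|\frac325^m\Delta_mu(x)-g(x)|\to0$). A solution of the Dirichlet problem is a continuous $u\in\mathrm{dom}\,\Delta$ with $\Delta u$ equal to the constant $\eta$ and the prescribed values on $V_0$. *)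

(* Defs.v *)
From HB Require Import structures.
From mathcomp Require Import all_boot all_order all_algebra.
From mathcomp Require Import all_classical all_reals all_analysis.

Set Implicit Arguments.
Unset Strict Implicit.
Unset Printing Implicit Defensive.

Import Order.TTheory GRing.Theory Num.Theory.
Import numFieldNormedType.Exports.

Local Open Scope classical_set_scope.
Local Open Scope ring_scope.

(* Indices 1, 2, 3 are represented by 'I_3.  A function on the gasket K is a
   total function on the plane of which only the restriction to K matters:
   continuity is {within K, continuous u}, equality is agreement on K. *)

Section Gasket.
Variables (R : realType) (q : 'I_3 -> 'rV[R]_2).
Implicit Types (x y : 'rV[R]_2) (u g h f : 'rV[R]_2 -> R) (K : set 'rV[R]_2).

(* The library norm on 'rV[R]_2 is the sup norm (same topology), so the
   Euclidean distance has to be spelled out. *)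
Definition edist x y : R := Num.sqrt (\sum_(k < 2) (x 0 k - y 0 k) ^+ 2).

Definition equilateral : Prop :=
  exists2 s : R, 0 < s & forall i j : 'I_3, i != j -> edist (q i) (q j) = s.

Definition contraction (i : 'I_3) x : 'rV[R]_2 := 2^-1 *: (x + q i).

(* By Hutchinson's theorem exactly one set K satisfies this predicate. *)
Definition is_gasket K : Prop :=
  [/\ K !=set0, compact K & K = \bigcup_(i : 'I_3) (contraction i @` K)].

Definition word_map (w : seq 'I_3) x : 'rV[R]_2 := foldr contraction x w.

Definition cell_vertices (w : seq 'I_3) : set 'rV[R]_2 :=
  word_map w @` range q.

Definition vertices (m : nat) : set 'rV[R]_2 :=
  \bigcup_(w in [set w : seq 'I_3 | size w = m]) cell_vertices w.

Definition adjacent (m : nat) x y : Prop :=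
  x <> y /\ exists w : seq 'I_3,
    [/\ size w = m, cell_vertices w x & cell_vertices w y].

(* Summing over ordered pairs counts each unordered edge twice. *)
Definition energy (m : nat) u : R :=
  (5 / 3) ^+ m *
  (2^-1 * \sum_(p \in [set p : 'rV[R]_2 * 'rV[R]_2 | adjacent m p.1 p.2])
            (u p.1 - u p.2) ^+ 2).

Definition harmonic h : Prop :=
  forall m : nat, (1 <= m)%N -> energy m.-1 h = energy m h.

Definition is_FIF K (d : R) f : Prop :=
  [/\ -1 < d < 1,
      {within K, continuous f} &
      exists h : 'I_3 -> 'rV[R]_2 -> R,
        (forall i, harmonic (h i)) /\
        (forall i x, K x -> f (contraction i x) = d * f x + h i x)].

Definition graph_laplacian (m : nat) u x : R :=
  \sum_(y \in [set y : 'rV[R]_2 | adjacent m y x]) (u y - u x).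

Definition has_laplacian K u g : Prop :=
  [/\ {within K, continuous u},
      {within K, continuous g} &
      forall e : R, 0 < e -> \forall m \near \oo,
        forall x, (vertices m `\` vertices 0) x ->
          `| 3 / 2 * 5 ^+ m * graph_laplacian m u x - g x | < e].

Definition dirichlet_solution K (a : 'I_3 -> R) (eta : R) u : Prop :=
  (forall i, u (q i) = a i) /\ has_laplacian K u (fun=> eta).

(* For distinct i, j in {1, 2, 3}, the index 6 - i - j is the third one, k. *)
Definition interpolation_values (a : 'I_3 -> R) (eta : R) f : Prop :=
  (forall i, f (q i) = a i) /\
  (forall i j k : 'I_3, uniq [:: i; j; k] ->
     f (contraction i (q j)) = 5^-1 * (2 * a i + 2 * a j + a k - eta / 3)).

End Gasket.

(* Main.v *)
Require Import Defs.
From HB Require Import structures.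
From mathcomp Require Import all_boot all_order all_algebra.
From mathcomp Require Import all_classical all_reals all_analysis.
From mathcomp Require Import ring lra.

Set Implicit Arguments.
Unset Strict Implicit.
Unset Printing Implicit Defensive.

Import Order.TTheory GRing.Theory Num.Theory.
Import numFieldNormedType.Exports.
(* [edist] and [contraction] also name notions of the analysis library. *)
Import Defs.

Local Open Scope classical_set_scope.
Local Open Scope ring_scope.

(** The discrete Poisson rule with source [eta] prescribes, in every cell of
    level [m], the values at the three edge midpoints from the values at the
    three corners by the formula of the theorem with [eta / 5 ^ m] in place of
    [eta].  Everything rests on four facts about this rule.

    - It is self-similar: if [g] obeys it with source [eta], then [g] composed
      with a contraction obeys it with source [eta / 5]; and it is linear in
      the pair of [g] and [eta].  So a solution is determined on the dense set
      of all vertices by its three boundary values ([poisson_rule_unique]).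
    - It has a continuous solution for all boundary values ([spline_rule],
      [spline_continuous]).  Passing from a cell to a subcell multiplies the
      oscillation of the corner values plus one sixth of the source by at most
      [3 / 5] ([spread_subdivide]), so following the digits of a point yields a
      convergent sequence of values.  Its limit does not depend on the choice
      of digits because two cells meet in a single common vertex
      ([cell_meet]).
    - A solution has renormalized graph Laplacian exactly [eta] at every level
      ([poisson_rule_graph_laplacian]).  Hence it solves the Dirichlet problem.
      The difference [d] of two solutions of that problem has renormalized
      Laplacian tending uniformly to zero; adding a small multiple of the spline
      with source 1 and zero boundary values makes [d] strictly subharmonic on
      a fine graph, and the maximum principle shows that [d] vanishes.
    - With source 0 the rule characterizes harmonic functions ([harmonicP]): in
      one cell, refining the graph raises the energy by a positive definite
      quadratic form in the deviations from the rule ([energy1B]).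

    The link with interpolation functions is that, for [g] with source [eta],
    the source [eta / 5] of [g] composed with a contraction is exactly
    cancelled by that of [g / 5]: the difference is harmonic, so [g] is a
    fractal interpolation function with scaling factor [1 / 5].  Read
    backwards, this shows that such an interpolation function with the given
    values at level 1 obeys the rule on all cells, hence equals the solution.

    All sums over the graph of level [m + 1] are split into three sums over the
    graph of level [m] ([graph_laplacianS], [energyS]), so that the statements
    on Laplacians and energies go by induction on [m]. *)

(** * Geometric decay *)

Section GeometricDecay.
Variable R : realType.

Lemma geometric_small (D r e : R) :
  0 <= r < 1 -> 0 < e -> exists n, D * r ^+ n < e.
Proof.
move=> /andP[r0 r1] e0.
have c : geometric D r @ \oo --> (0 : R) by apply: cvg_geometric; rewrite ger0_norm.
have /cvgr_dist_lt/(_ e e0)[n _ /(_ n (leqnn n))] := c.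
by rewrite /= sub0r normrN => h; exists n; exact: le_lt_trans (ler_norm _) h.
Qed.

Lemma norm0_geometric (V : normedModType R) (v : V) (D r : R) :
  0 <= r < 1 -> (forall n, `|v| <= D * r ^+ n) -> v = 0.
Proof.
move=> hr h; apply/eqP/negPn/negP; rewrite -normr_gt0 => v0.
by have [n] := geometric_small D hr v0; rewrite ltNge h.
Qed.

Lemma half_itv : 0 <= (2^-1 : R) < 1.
Proof. by apply/andP; split; lra. Qed.

End GeometricDecay.

(** * Geometry of the gasket *)

Section Geometry.
Variables (R : realType) (q : 'I_3 -> 'rV[R]_2) (K : set 'rV[R]_2).
Hypotheses (hq : equilateral q) (hK : is_gasket q K).
Implicit Types (x y z : 'rV[R]_2) (i j k : 'I_3) (w : seq 'I_3) (m n : nat).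

Local Notation P := (contraction q).

Definition dot x y : R := \sum_(k < 2) x 0 k * y 0 k.

Lemma dotE x y : dot x y = x 0 0 * y 0 0 + x 0 1 * y 0 1.
Proof. by rewrite /dot big_ord_recl big_ord1; congr (_ + x 0 _ * y 0 _); exact/val_inj. Qed.

Lemma dotDl x y z : dot (x + y) z = dot x z + dot y z.
Proof. by rewrite !dotE !mxE; ring. Qed.

Lemma dotZl (c : R) x z : dot (c *: x) z = c * dot x z.
Proof. by rewrite !dotE !mxE; ring. Qed.

Lemma dot_continuous z : continuous (dot^~ z).
Proof.
have -> : dot^~ z = (fun x => x 0 0 * z 0 0 + x 0 1 * z 0 1).
  by apply/funext => x; rewrite dotE.
move=> x.
have cx (k : 'I_2) : (fun y : 'rV[R]_2 => y 0 k) @ x --> x 0 k by exact: coord_continuous.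
exact: (cvgD (cvgM (cx 0) (cvg_cst _)) (cvgM (cx 1) (cvg_cst _))).
Qed.

Lemma edist_sqr x y : edist x y ^+ 2 = dot (x - y) (x - y).
Proof.
rewrite /edist sqr_sqrtr; last by apply: sumr_ge0 => k _; exact: sqr_ge0.
by apply: eq_bigr => k _; rewrite !mxE expr2.
Qed.

(** By the polarization identity the two sides differ by half the square of the
    side length if [k != i], and by its whole if [k = i]. *)
Lemma vertices_acute i j k : i != j -> k != j ->
  dot (q k) (q j - q i) < dot (q j) (q j - q i).
Proof.
move=> ij kj; have [s s0 hs] := hq.
have sq a b : a != b -> dot (q a - q b) (q a - q b) = s ^+ 2.
  by move=> /hs <-; rewrite edist_sqr.
have := sq _ _ ij; have := sq _ _ kj.
have s2 : 0 < s ^+ 2 by rewrite exprn_gt0.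
have [->|ki] := eqVneq k i; last (have := sq _ _ ki).
  by rewrite !dotE !mxE => ? ?; lra.
by rewrite !dotE !mxE => ? ? ?; lra.
Qed.

Lemma vertex_inj : injective q.
Proof.
move=> i j ij; apply/eqP/negPn/negP => nij.
by have := vertices_acute nij nij; rewrite ij ltxx.
Qed.

Lemma contraction_inj i : injective (P i).
Proof.
move=> x y /(congr1 (fun z => 2 *: z - q i)).
by rewrite /contraction !scalerA divff ?pnatr_eq0// !scale1r !addrK.
Qed.

Lemma contractionK i x : 2 *: P i x - q i = x.
Proof. by rewrite /contraction scalerA divff ?pnatr_eq0// scale1r addrK. Qed.

Lemma expansionK i x : P i (2 *: x - q i) = x.
Proof. by rewrite /contraction subrK scalerA mulVf ?pnatr_eq0// scale1r. Qed.

Lemma contraction_vertex i : P i (q i) = q i.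
Proof.
by rewrite /contraction -mulr2n -[q i *+ 2]scaler_nat scalerA mulVf ?pnatr_eq0// scale1r.
Qed.

Lemma contraction_vertexC i j : P i (q j) = P j (q i).
Proof. by rewrite /contraction addrC. Qed.

Lemma gasket_contraction i x : K x -> K (P i x).
Proof. by move=> Kx; case: hK => _ _ ->; exists i => //; exists x. Qed.

Lemma gasket_preimage x : K x -> exists i, exists2 y, K y & x = P i y.
Proof. by case: hK => _ _ {1}-> [i _ [y Ky <-]]; exists i, y. Qed.

Lemma gasket_closed : closed K.
Proof. by case: hK => _ /compact_closed-/(_ (@norm_hausdorff _ _)). Qed.

Lemma gasket_norm_bound : exists D : R, forall x, K x -> `|x| <= D.
Proof.
case: hK => _ /compact_bounded[M [Mr hM]] _; exists (M + 1) => x Kx.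
by apply: (hM (M + 1)) => //; rewrite ltrDl.
Qed.

Lemma gasket_diameter_bound :
  exists D : R, forall x y, K x -> K y -> `|x - y| <= D.
Proof.
have [D hD] := gasket_norm_bound; exists (D + D) => x y Kx Ky.
by rewrite (le_trans (ler_normB _ _))// lerD// hD.
Qed.

Lemma contraction_dist i x y : `|P i x - P i y| = 2^-1 * `|x - y|.
Proof.
by rewrite /contraction -scalerBr opprD addrACA subrr addr0 normrZ ger0_norm.
Qed.

Lemma word_map_dist w x y :
  `|word_map q w x - word_map q w y| = `|x - y| * 2^-1 ^+ size w.
Proof.
by elim: w => [|i w IH] /=; rewrite ?mulr1// contraction_dist IH exprS; ring.
Qed.

Lemma word_map_rcons w i x : word_map q (rcons w i) x = word_map q w (P i x).
Proof. by rewrite /word_map foldr_rcons. Qed.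

Lemma gasket_word_map w x : K x -> K (word_map q w x).
Proof. by move=> Kx; elim: w => //= i w; exact: gasket_contraction. Qed.

Lemma gasket_cells n x : K x ->
  exists w y, [/\ size w = n, K y & x = word_map q w y].
Proof.
elim: n x => [|n IH] x Kx; first by exists [::], x.
have [i [y Ky ->]] := gasket_preimage Kx; have [w [z [sw Kz ->]]] := IH _ Ky.
by exists (i :: w), z; rewrite /= sw.
Qed.

(** The vertex is the limit of the iterates of its contraction, started
    anywhere in the closed set [K]. *)
Lemma gasket_vertex i : K (q i).
Proof.
have [[x Kx] _ _] := hK.
have c : (fun n => q i - geometric 1 2^-1 n *: (q i - x)) @ \oo --> q i.
  rewrite -[X in _ --> X]subr0 -(scale0r (q i - x)); apply: cvgB; first exact: cvg_cst.
  apply: cvgZr_tmp; apply: cvg_geometric; rewrite ger0_norm; lra.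
apply: (closed_cvg K gasket_closed _ _ c); apply: nearW => n.
suff -> : q i - geometric 1 2^-1 n *: (q i - x) = iter n (P i) x.
  by elim: n => //= n; exact: gasket_contraction.
elim: n => [|n IH]; first by rewrite /geometric/= mulr1 scale1r subKr.
rewrite [RHS]/= -IH /geometric /= !mul1r exprS.
by apply/rowP => l; rewrite /contraction !mxE; field.
Qed.

(** The maximum over [K] of a linear form is at most the mean of itself and one
    of the values at the vertices, hence at most the largest of these. *)
Lemma gasket_dot_le i j x : i != j -> K x ->
  dot x (q j - q i) <= dot (q j) (q j - q i).
Proof.
move=> ij Kx; have [K0 cK _] := hK; set z := q j - q i.
have [c /set_mem Kc hc] := compact_EVT_max K0 cK (continuous_subspaceT (@dot_continuous z)).
have [l [y Ky cE]] := gasket_preimage Kc.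
have yc := hc _ (mem_set Ky); have xc := hc _ (mem_set Kx).
have lj : dot (q l) z <= dot (q j) z.
  by have [->//|/(vertices_acute ij)/ltW] := eqVneq l j.
move: xc yc; rewrite {1 2}cE /contraction dotZl dotDl; lra.
Qed.

(** A point attaining the bound lies in cell [j], and its preimage under [P j]
    attains the bound too; so it lies in the cells of all levels at [q j], which
    shrink to that vertex. *)
Lemma gasket_exposed_vertex i j x : i != j -> K x ->
  dot x (q j - q i) = dot (q j) (q j - q i) -> x = q j.
Proof.
move=> ij Kx xj; have [D hD] := gasket_diameter_bound.
apply/eqP; rewrite -subr_eq0; apply/eqP.
apply: (norm0_geometric (D := D) (half_itv R)) => n.
elim: n x Kx xj => [|n IH] x Kx xj.
  by rewrite mulr1 hD//; exact: gasket_vertex.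
have [l [y Ky xE]] := gasket_preimage Kx.
have yj := gasket_dot_le ij Ky.
have lj : l = j.
  apply/eqP/negPn/negP => /(vertices_acute ij).
  by move: xj; rewrite xE /contraction dotZl dotDl; lra.
rewrite xE lj -{1}(contraction_vertex j) contraction_dist.
rewrite exprS mulrCA ler_pM2l ?invr_gt0// IH//.
by move: xj; rewrite xE lj /contraction dotZl dotDl; lra.
Qed.

(** Distinct cells meet only in their common vertex: [P i x = P j y] says that
    [x - y = q j - q i], and the linear form given by [q j - q i] varies by so
    much on [K] only between its minimizer [q i] and its maximizer [q j]. *)
Lemma cell_meet i j x y : i != j -> K x -> K y -> P i x = P j y ->
  x = q j /\ y = q i.
Proof.
have main a b u v : a != b -> K u -> K v -> P a u = P b v -> u = q b.
  move=> ab Ku Kv uv; apply: (gasket_exposed_vertex ab Ku); apply/eqP.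
  rewrite eq_le gasket_dot_le//=.
  have := gasket_dot_le (_ : b != a) Kv; rewrite eq_sym => /(_ ab).
  have -> : u = v + (q b - q a).
    by rewrite -(contractionK a u) uv -{2}(contractionK b v) !addrA subrK.
  rewrite !dotE !mxE; lra.
move=> ij Kx Ky xy; split; first exact: main xy.
by apply: main (esym xy); rewrite // eq_sym.
Qed.

Lemma contraction_eq_vertex i j x : K x -> P i x = q j -> i = j /\ x = q j.
Proof.
rewrite -{1}(contraction_vertex j) => Kx.
have [-> /contraction_inj//|ij] := eqVneq i j.
move=> /(cell_meet ij Kx (gasket_vertex j))[_ /vertex_inj ji].
by rewrite ji eqxx in ij.
Qed.

(** The points [W w (q i)] are dense in [K]. *)
Lemma eq_on_gasket (f g : 'rV[R]_2 -> R) :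
  {within K, continuous f} -> {within K, continuous g} ->
  (forall w i, f (word_map q w (q i)) = g (word_map q w (q i))) ->
  forall x, K x -> f x = g x.
Proof.
move=> /subspace_continuousP cf /subspace_continuousP cg fg x Kx.
have [D hD] := gasket_diameter_bound.
have /choice[s hs] n : exists y, [/\ K y, f y = g y & `|x - y| <= D * 2^-1 ^+ n].
  have [w [y [<- Ky ->]]] := gasket_cells n Kx.
  exists (word_map q w (q 0)); split => //.
    by apply: gasket_word_map; exact: gasket_vertex.
  rewrite word_map_dist ler_wpM2r ?exprn_ge0 ?invr_ge0// hD//.
  exact: gasket_vertex.
have sx : s @ \oo --> within K (nbhs x).
  move=> A /= /nbhs_ballP[e /= e0 he].
  have c : geometric D 2^-1 @ \oo --> (0 : R).
    by apply: cvg_geometric; rewrite ger0_norm; lra.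
  have /cvgr_dist_lt/(_ e e0) := c.
  apply: filterS => n; rewrite sub0r normrN => hn.
  have [Ks _ xs] := hs n; apply: he => //.
  rewrite -ball_normE /=; apply: le_lt_trans xs _.
  by apply: le_lt_trans (ler_norm _) hn.
have cf' : f \o s @ \oo --> f x by exact: cvg_trans (cvg_app f sx) (cf x Kx).
have cg' : g \o s @ \oo --> g x by exact: cvg_trans (cvg_app g sx) (cg x Kx).
have -> : f x = lim (f \o s @ \oo) by exact/esym/cvg_lim.
have -> : f \o s = g \o s by apply/funext => n /=; have [] := hs n.
exact: cvg_lim.
Qed.

End Geometry.

(** * Sums over the three cells *)

Lemma uniq3E (T : eqType) (i j k : T) :
  uniq [:: i; j; k] = [&& i != j, i != k & j != k].
Proof. by rewrite /= !inE negb_or andbT andbA. Qed.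

Lemma uniq3_swap (T : eqType) (i j k : T) : uniq [:: i; j; k] -> uniq [:: i; k; j].
Proof. by rewrite !uniq3E => /and3P[-> -> ?]; rewrite eq_sym. Qed.

Lemma uniq3_rot (T : eqType) (i j k : T) : uniq [:: i; j; k] -> uniq [:: j; k; i].
Proof. by rewrite -(rot_uniq 1). Qed.

Section FiniteSums.
Variable R : realType.

Lemma mem_ord3 (i j k l : 'I_3) : uniq [:: i; j; k] -> l \in [:: i; j; k].
Proof.
move=> u; have /subset_cardP/(_ (subset_predT _)) -> // : #|[:: i; j; k]| = #|{: 'I_3}|.
by rewrite (card_uniqP u) card_ord.
Qed.

Lemma third_index (i j : 'I_3) : i != j -> exists k, uniq [:: i; j; k].
Proof.
move=> ij; suff [k hk] : exists k, k \notin [:: i; j].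
  exists k; move: hk; rewrite /= !inE !negb_or ij !andbT => /andP[ki kj].
  by rewrite eq_sym ki eq_sym.
apply/existsP; rewrite -negb_forall; apply/negP => /forallP all.
have : (#|{: 'I_3}| <= #|[:: i; j]|)%N.
  by apply/subset_leq_card/fintype.subsetP => l _; exact: all.
by rewrite card_ord => /leq_trans/(_ (card_size _)).
Qed.

Lemma sum_ord3 (F : 'I_3 -> R) i j k : uniq [:: i; j; k] ->
  \sum_l F l = F i + F j + F k.
Proof.
move=> u; rewrite -addrA.
transitivity (\sum_(l <- [:: i; j; k]) F l); last by rewrite !big_cons big_nil addr0.
by rewrite [RHS]big_uniq//; apply: eq_bigl => l; rewrite mem_ord3.
Qed.

Lemma fsum_fin (T : finType) (F : T -> R) :
  \sum_(i \in [set: T]) F i = \sum_i F i.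
Proof.
rewrite (fsbigE (index_enum T)) ?index_enum_uniq//.
  by apply: eq_bigl => i; rewrite in_setT.
by move=> i _; rewrite mem_index_enum.
Qed.

(** The form in which sums over a graph approximation split over the three
    cells, [h i] being the passage from the whole gasket to cell [i]. *)
Lemma fsum_cells (T T' : choiceType) (A : 'I_3 -> set T) (h : 'I_3 -> T -> T')
    (F : T' -> R) :
  (forall i, finite_set (A i)) -> (forall i, injective (h i)) ->
  (forall i j x y, A i x -> A j y -> h i x = h j y -> i = j) ->
  \sum_(y \in \bigcup_i (h i @` A i)) F y = \sum_i \sum_(x \in A i) F (h i x).
Proof.
move=> fA hinj disj.
have fhA i : finite_set (h i @` A i) by exact: finite_image.
pose a : 'I_3 := ord0; pose b : 'I_3 := ord_max.
have [c abc] : exists c, uniq [:: a; b; c] by exact: third_index.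
have cov i : [\/ i = a, i = b | i = c].
  have := mem_ord3 i abc; rewrite !inE => /or3P[]/eqP ->.
  - by constructor 1.
  - by constructor 2.
  - by constructor 3.
have -> : \bigcup_i (h i @` A i) = h a @` A a `|` (h b @` A b `|` h c @` A c).
  apply/seteqP; split => [y [i _ hi]|y [|[]] hi]; last 3 first.
  - by exists a.
  - by exists b.
  - by exists c.
  by case: (cov i) => E; rewrite E in hi; [left|right; left|right; right].
have dj i j : i != j -> h i @` A i `&` h j @` A j `<=` set0.
  move=> ij y [[x Ax <-] [z Az zx]].
  by move: ij; rewrite (disj _ _ _ _ Ax Az (esym zx)) eqxx.
have [ab ac bc] : [/\ a != b, a != c & b != c].
  by move: abc; rewrite /= !inE negb_or => /and3P[/andP[]].
rewrite fsbigU0 ?finite_setU//; last first.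
  by rewrite setIUr => y [/(dj a b ab)|/(dj a c ac)].
rewrite fsbigU0//; last exact: dj.
rewrite (sum_ord3 _ abc) -addrA.
by rewrite !fsbig_image// => x y _ _; exact: hinj.
Qed.

End FiniteSums.

(** * The graph approximations *)

Section Discrete.
Variables (R : realType) (q : 'I_3 -> 'rV[R]_2) (K : set 'rV[R]_2).
Hypotheses (hq : equilateral q) (hK : is_gasket q K).
Implicit Types (x y z : 'rV[R]_2) (i j k : 'I_3) (w : seq 'I_3) (m n : nat).
Implicit Types (u f g : 'rV[R]_2 -> R) (eta : R).

Local Notation P := (contraction q).
Local Notation W := (word_map q).

Lemma verticesP m x :
  vertices q m x <-> exists w i, size w = m /\ x = W w (q i).
Proof.
split=> [[w /= sw [_ [i _ <-] <-]]|[w [i [sw ->]]]]; first by exists w, i.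
by exists w => //; exists (q i) => //; exists i.
Qed.

Lemma vertices0 : vertices q 0 = range q.
Proof.
apply/seteqP; split=> x.
  by move=> /verticesP[w [i [/size0nil -> ->]]]; exists i.
by move=> [i _ <-]; apply/verticesP; exists [::], i.
Qed.

Lemma verticesS m : vertices q m.+1 = \bigcup_i (P i @` vertices q m).
Proof.
apply/seteqP; split=> x.
  move=> /verticesP[[|i w] [j [//= [sw] ->]]]; exists i => //.
  by exists (W w (q j)) => //; apply/verticesP; exists w, j.
move=> [i _ [_ /verticesP[w [j [<- ->]]] <-]].
by apply/verticesP; exists (i :: w), j.
Qed.

Lemma vertices_gasket m : vertices q m `<=` K.
Proof.
move=> x /verticesP[w [i [_ ->]]].
by apply: (gasket_word_map hK); exact: (gasket_vertex hK).
Qed.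

Lemma vertices_vertex m i : vertices q m (q i).
Proof.
elim: m => [|m IH]; first by rewrite vertices0; exists i.
by rewrite verticesS; exists i => //; exists (q i) => //; exact: contraction_vertex.
Qed.

Lemma finite_vertices m : finite_set (vertices q m).
Proof.
elim: m => [|m IH]; first by rewrite vertices0; apply: finite_image.
by rewrite verticesS; apply: bigcup_finite => // i _; exact: finite_image.
Qed.

Lemma adjacent_vertices m x y :
  adjacent q m x y -> vertices q m x /\ vertices q m y.
Proof. by move=> [_ [w [sw cx cy]]]; split; exists w. Qed.

Lemma adjacent0 x y :
  adjacent q 0 x y <-> exists i j, [/\ i != j, x = q i & y = q j].
Proof.
split=> [[xy [w [/size0nil -> [_ [i _ <-] /= xi] [_ [j _ <-] /= yj]]]]|].
  exists i, j; split => //; apply/eqP => ij; apply: xy.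
  by rewrite -xi -yj ij.
move=> [i [j [ij -> ->]]]; split; first by move=> /(vertex_inj hq)/eqP; exact/negP.
by exists [::]; split => //; apply: imageP; [exists i|exists j].
Qed.

Lemma adjacentS m x y : adjacent q m.+1 x y <->
  exists i x' y', [/\ adjacent q m x' y', x = P i x' & y = P i y'].
Proof.
split=> [[xy [[|i w] [//= [sw] [a qa xa] [b qb yb]]]]|].
  exists i, (W w a), (W w b); split; [split|exact/esym|exact/esym].
    by move=> ab; apply: xy; rewrite -xa -yb /= ab.
  by exists w; split => //; exact: imageP.
move=> [i [a [b [[ab [w [sw [c qc ca] [d qd db]]]] -> ->]]]]; split.
  by move=> /contraction_inj.
by exists (i :: w); split; rewrite /= ?sw// -?ca -?db; [exists c|exists d].
Qed.

(** An edge lies in a single cell: two cells share one vertex only. *)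
Lemma adjacent_cell_inj m i j x x' y y' :
  adjacent q m x x' -> adjacent q m y y' ->
  P i x = P j y -> P i x' = P j y' -> i = j.
Proof.
move=> ax ay xy xy'; apply/eqP/negPn/negP => ij.
have [/vertices_gasket Kx /vertices_gasket Kx'] := adjacent_vertices ax.
have [/vertices_gasket Ky /vertices_gasket Ky'] := adjacent_vertices ay.
have [xq _] := cell_meet hq hK ij Kx Ky xy.
have [xq' _] := cell_meet hq hK ij Kx' Ky' xy'.
by case: ax; rewrite xq xq'.
Qed.

Lemma finite_adjacent m x : finite_set [set y | adjacent q m y x].
Proof.
apply: (sub_finite_set _ (finite_vertices m)) => y /=.
by move=> /adjacent_vertices[].
Qed.

Lemma finite_edges m :
  finite_set [set p : 'rV[R]_2 * 'rV[R]_2 | adjacent q m p.1 p.2].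
Proof.
have := finite_setX (finite_vertices m) (finite_vertices m).
by apply: sub_finite_set => -[x y] /= /adjacent_vertices.
Qed.

Lemma graph_laplacian0 u i :
  graph_laplacian q 0 u (q i) = \sum_j (u (q j) - u (q i)).
Proof.
rewrite /graph_laplacian.
have -> : [set y | adjacent q 0 y (q i)] = q @` [set j | j != i].
  apply/seteqP; split=> y /=.
    by move=> /adjacent0[j [k [jk -> /(vertex_inj hq) ->]]]; exists j.
  by move=> [j ji <-]; apply/adjacent0; exists j, i.
rewrite fsbig_image; last by move=> j k _ _; exact: vertex_inj.
rewrite (fsbig_widen _ [set: 'I_3])//; first exact: fsum_fin.
by move=> j /= [_ /negP/negPn/eqP ->]; rewrite subrr.
Qed.

Lemma graph_laplacian_notin m u x : ~ vertices q m x -> graph_laplacian q m u x = 0.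
Proof.
move=> nx; rewrite /graph_laplacian (_ : [set y | _] = set0) ?fsbig_set0//.
by rewrite -subset0 => y /= /adjacent_vertices[].
Qed.

Lemma graph_laplacianS m u x : graph_laplacian q m.+1 u x =
  \sum_i graph_laplacian q m (fun y => u (P i y)) (2 *: x - q i).
Proof.
rewrite /graph_laplacian.
have -> : [set y | adjacent q m.+1 y x] =
    \bigcup_i (P i @` [set y | adjacent q m y (2 *: x - q i)]).
  apply/seteqP; split=> y /=.
    move=> /adjacentS[i [a [b [ab -> ->]]]].
    by exists i => //; exists a => //=; rewrite contractionK.
  move=> [i _ [a /= ax <-]]; apply/adjacentS.
  by exists i, a, (2 *: x - q i); rewrite expansionK.
rewrite fsum_cells => [|i|i|i j y z /= yx zx yz].
- by apply: eq_bigr => i _; apply: eq_fsbigr => y _; rewrite expansionK.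
- exact: finite_adjacent.
- exact: contraction_inj.
- by apply: (adjacent_cell_inj yx zx yz); rewrite !expansionK.
Qed.

Lemma graph_laplacian_lin m (a b : R) f g x :
  graph_laplacian q m (fun y => a * f y + b * g y) x =
  a * graph_laplacian q m f x + b * graph_laplacian q m g x.
Proof.
rewrite /graph_laplacian !mulr_fsumr -fsbig_split; last exact: finite_adjacent.
by apply: eq_fsbigr => y _ /=; ring.
Qed.

End Discrete.

(** * The discrete Poisson rule and its Laplacian *)

Section Rule.
Variables (R : realType) (q : 'I_3 -> 'rV[R]_2) (K : set 'rV[R]_2).
Hypotheses (hq : equilateral q) (hK : is_gasket q K).
Implicit Types (x y z : 'rV[R]_2) (i j k : 'I_3) (w : seq 'I_3) (m n : nat).
Implicit Types (u f g : 'rV[R]_2 -> R) (eta : R).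

Local Notation P := (contraction q).
Local Notation W := (word_map q).

(** The values in the theorem, repeated in every cell: the cell of [w] is the
    gasket halved [size w] times, and pulling a function back by one halving
    divides its Laplacian by 5. *)
Definition poisson_rule eta g : Prop :=
  forall w i j k, uniq [:: i; j; k] ->
    g (W w (P i (q j))) =
    5^-1 * (2 * g (W w (q i)) + 2 * g (W w (q j)) + g (W w (q k))
            - eta / 5 ^+ size w / 3).

Lemma poisson_rule0 eta g i j k : poisson_rule eta g -> uniq [:: i; j; k] ->
  g (P i (q j)) = 5^-1 * (2 * g (q i) + 2 * g (q j) + g (q k) - eta / 3).
Proof. by move=> hg /(hg [::]) /= ->; rewrite expr0 divr1. Qed.

Lemma poisson_rule_cell eta g i :
  poisson_rule eta g -> poisson_rule (eta / 5) (fun x => g (P i x)).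
Proof.
move=> hg w a b c /(hg (i :: w)) /= ->.
by rewrite exprS invfM !mulrA.
Qed.

Lemma poisson_rule_lin (a b eta1 eta2 : R) f g :
  poisson_rule eta1 f -> poisson_rule eta2 g ->
  poisson_rule (a * eta1 + b * eta2) (fun x => a * f x + b * g x).
Proof. by move=> hf hg w i j k ijk; rewrite (hf w _ _ _ ijk) (hg w _ _ _ ijk); ring. Qed.

Lemma poisson_rule_unique eta f g :
  poisson_rule eta f -> poisson_rule eta g -> (forall i, f (q i) = g (q i)) ->
  forall w i, f (W w (q i)) = g (W w (q i)).
Proof.
move=> hf hg fg w; elim: w eta f g hf hg fg => [|l w IH] eta f g hf hg fg i //=.
apply: (IH (eta / 5) (fun x => f (P l x)) (fun x => g (P l x))).
- exact: poisson_rule_cell.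
- exact: poisson_rule_cell.
move=> j; have [<-|lj] := eqVneq l j; first by rewrite contraction_vertex.
have [k ljk] := third_index lj.
by rewrite (poisson_rule0 hf ljk) (poisson_rule0 hg ljk) !fg.
Qed.

(** A point of cell [i] other than its junctions with the other cells has all
    its neighbours in that cell. *)
Lemma graph_laplacian_cell m u i y :
  K y -> (forall j, j != i -> y <> q j) ->
  graph_laplacian q m.+1 u (P i y) = graph_laplacian q m (fun x => u (P i x)) y.
Proof.
move=> Ky yq; rewrite (graph_laplacianS hq hK) (bigD1 i)//= contractionK big1 ?addr0//.
move=> j ji; apply: graph_laplacian_notin => /(vertices_gasket hK) Kz.
have ij : i != j by rewrite eq_sym.
by have [/(yq j ji)] := cell_meet hq hK ij Ky Kz (esym (expansionK _ _ _)).
Qed.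

Lemma graph_laplacian_junction m u i j : i != j ->
  graph_laplacian q m.+1 u (P i (q j)) =
  graph_laplacian q m (fun x => u (P i x)) (q j) +
  graph_laplacian q m (fun x => u (P j x)) (q i).
Proof.
move=> ij; have [k ijk] := third_index ij.
rewrite (graph_laplacianS hq hK) (sum_ord3 _ ijk) contractionK.
rewrite {1}(contraction_vertexC q i j) contractionK.
rewrite [X in _ + X]graph_laplacian_notin ?addr0// => /(vertices_gasket hK) Kz.
have [ik jk] : i != k /\ j != k.
  by move: ijk; rewrite uniq3E => /and3P[].
have [/(vertex_inj hq) jkE _] :=
  cell_meet hq hK ik (gasket_vertex hK j) Kz (esym (expansionK _ _ _)).
by rewrite jkE eqxx in jk.
Qed.

(** The sum of the differences along the two edges at a boundary vertex obeys the
    recursion [X(m+1) = 3/5 X(m) - 2/15 eta 5^-m], of which this is the closed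
    form. *)
Lemma boundary_graph_laplacian m eta g i : poisson_rule eta g ->
  graph_laplacian q m g (q i) =
  (3 / 5) ^+ m * (\sum_j (g (q j) - g (q i))) - eta / 3 * ((3 / 5) ^+ m - 5^-1 ^+ m).
Proof.
elim: m eta g => [|m IH] eta g hg.
  by rewrite (graph_laplacian0 hq) !expr0 subrr mulr0 subr0 mul1r.
have [j ij] : exists j, i != j.
  have [->|] := eqVneq i ord0; first by exists ord_max.
  by exists ord0.
have [k ijk] := third_index ij.
have ikj := uniq3_swap ijk.
rewrite -{1}(contraction_vertex q i) graph_laplacian_cell; last 2 first.
- exact: (gasket_vertex hK).
- by move=> l li /(vertex_inj hq)/eqP; rewrite eq_sym; exact/negP.
rewrite (IH (eta / 5)); last exact: poisson_rule_cell.
rewrite !(sum_ord3 _ ijk) contraction_vertex.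
rewrite (poisson_rule0 hg ijk) (poisson_rule0 hg ikj) !exprS; by field.
Qed.

(** At a junction [P i (q j)] the two one-sided sums of
    [boundary_graph_laplacian] add up: their [(3 / 5) ^+ m] terms cancel by the
    midpoint rule.  Every other vertex lies inside one cell, where induction
    applies. *)
Lemma poisson_rule_graph_laplacian m eta g x :
  poisson_rule eta g -> (vertices q m `\` vertices q 0) x ->
  graph_laplacian q m g x = 2 / 3 * eta * 5^-1 ^+ m.
Proof.
elim: m eta g x => [|m IH] eta g x hg [vx nx] //.
move: vx; rewrite verticesS => -[i _ [y vy yx]].
have Ky := vertices_gasket hK vy.
rewrite -{}yx in nx *.
have [yq|yq] := pselect (vertices q 0 y); last first.
  rewrite graph_laplacian_cell//; last first.
    by move=> j _ yj; apply: yq; rewrite yj; exact: vertices_vertex.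
  by rewrite (IH (eta / 5)) ?exprS//; [field|exact: poisson_rule_cell].
move: yq nx; rewrite vertices0 => -[j _ <-] nx.
have ij : i != j.
  by apply/eqP => ij; apply: nx; exists j; rewrite // ij contraction_vertex.
have [k ijk] := third_index ij.
have jki := uniq3_rot ijk; have jik := uniq3_swap jki.
have ikj := uniq3_swap ijk.
rewrite graph_laplacian_junction//.
rewrite !(boundary_graph_laplacian _ _ (poisson_rule_cell _ hg)).
rewrite !(sum_ord3 _ ijk) !contraction_vertex.
rewrite (poisson_rule0 hg ijk) (poisson_rule0 hg ikj).
rewrite (poisson_rule0 hg jik) (poisson_rule0 hg jki) !exprS; by field.
Qed.

(** * Energy *)

Lemma energy0 u : energy q 0 u = 2^-1 * \sum_i \sum_j (u (q i) - u (q j)) ^+ 2.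
Proof.
rewrite /energy expr0 mul1r; congr (_ * _).
have -> : [set p : 'rV[R]_2 * 'rV[R]_2 | adjacent q 0 p.1 p.2] =
    (fun p : 'I_3 * 'I_3 => (q p.1, q p.2)) @` [set p | p.1 != p.2].
  apply/seteqP; split=> -[y z] /=.
    by move=> /(adjacent0 hq)[j [k [jk -> ->]]]; exists (j, k).
  by move=> [[j k] /= jk [<- <-]]; apply/(adjacent0 hq); exists j, k.
rewrite fsbig_image; last first.
  by move=> [j k] [j' k'] _ _ [] /(vertex_inj hq) -> /(vertex_inj hq) ->.
rewrite (fsbig_widen _ [set: 'I_3 * 'I_3])//; last first.
  by move=> [j k] /= [_ /negP/negPn/eqP /= ->]; rewrite subrr expr0n.
by rewrite fsum_fin pair_bigA.
Qed.

Lemma energyS m u :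
  energy q m.+1 u = 5 / 3 * \sum_i energy q m (fun x => u (P i x)).
Proof.
rewrite /energy -mulr_sumr exprS -!mulrA; congr (5 * (_ * (_ * _))).
rewrite -mulr_sumr; congr (_ * _).
have -> : [set p : 'rV[R]_2 * 'rV[R]_2 | adjacent q m.+1 p.1 p.2] =
    \bigcup_i ((fun p => (P i p.1, P i p.2)) @`
      [set p : 'rV[R]_2 * 'rV[R]_2 | adjacent q m p.1 p.2]).
  apply/seteqP; split=> -[y z] /=.
    by move=> /adjacentS[i [a [b [ab -> ->]]]]; exists i => //; exists (a, b).
  by move=> [i _ [[a b] /= ab [<- <-]]]; apply/adjacentS; exists i, a, b.
rewrite fsum_cells// => [i|i|i j [a a'] [b b'] /= aa bb [ab ab']].
- exact: finite_edges.
- by move=> [a b] [c d] /= [/contraction_inj -> /contraction_inj ->].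
- exact: (adjacent_cell_inj hq hK aa bb ab ab').
Qed.

(** The deviation at a midpoint from the rule with source 0. *)
Definition midpoint_defect u i j k : R :=
  u (P i (q j)) - 5^-1 * (2 * u (q i) + 2 * u (q j) + u (q k)).

(** The form has no linear term in the defects because the harmonic extension
    minimizes the energy; each of its squares belongs to edges at the
    midpoints. *)
Lemma energy1B i j k u : uniq [:: i; j; k] ->
  let a := midpoint_defect u j k i in
  let b := midpoint_defect u i k j in
  let c := midpoint_defect u i j k in
  energy q 1 u - energy q 0 u =
  5 / 3 * (2 * (a ^+ 2 + b ^+ 2 + c ^+ 2) +
           ((a - b) ^+ 2 + (b - c) ^+ 2 + (c - a) ^+ 2)).
Proof.
move=> ijk a b c; rewrite energyS; under eq_bigr do rewrite energy0.
rewrite energy0 !(sum_ord3 _ ijk) !contraction_vertex /a /b /c /midpoint_defect.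
rewrite (contraction_vertexC q j i) (contraction_vertexC q k i).
rewrite (contraction_vertexC q k j); by field.
Qed.

(** Refining the graph cannot lower the energy: this holds in one cell by
    [energy1B], and the energies of the cells add up. *)
Lemma energy_le m u : energy q m u <= energy q m.+1 u.
Proof.
elim: m u => [|m IH] u.
  have [k hk] : exists k, uniq [:: ord0; ord_max; k] by exact: third_index.
  rewrite -subr_ge0 (energy1B _ hk)/= mulr_ge0//.
  by rewrite addr_ge0 ?mulr_ge0 ?addr_ge0// sqr_ge0.
by rewrite [leLHS]energyS energyS ler_pM2l// ler_sum.
Qed.

(** The energy increments of the three cells are nonnegative and sum to zero. *)
Lemma harmonic_cell u i : harmonic q u -> harmonic q (fun x => u (P i x)).
Proof.
move=> hu [//|m] _ /=; apply/eqP; rewrite eq_sym -subr_eq0.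
have : \sum_j (energy q m.+1 (fun x => u (P j x)) - energy q m (fun x => u (P j x))) == 0.
  rewrite sumrB subr_eq0; apply/eqP.
  apply: (@mulfI _ (5 / 3 : R)); first by rewrite mulf_neq0 ?invr_eq0 ?pnatr_eq0.
  by rewrite -!energyS; apply/esym/(hu m.+2).
rewrite psumr_eq0; last by move=> j _; rewrite subr_ge0 energy_le.
by move=> /allP/(_ i); rewrite mem_index_enum => /(_ isT).
Qed.

Lemma harmonicP u : harmonic q u <-> poisson_rule 0 u.
Proof.
split=> hu.
  move=> w; elim: w u hu => [|l w IH] u hu i j k ijk; last first.
    by rewrite /= (IH _ (harmonic_cell l hu) _ _ _ ijk) !mul0r.
  have /esym/eqP := hu 1%N isT; rewrite -subr_eq0 (energy1B _ ijk)/=.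
  set a := midpoint_defect u j k i; set b := midpoint_defect u i k j.
  set c := midpoint_defect u i j k => abc.
  have : c = 0.
    apply/eqP; rewrite -sqrf_eq0 eq_le sqr_ge0 andbT.
    have := sqr_ge0 a; have := sqr_ge0 b.
    have := sqr_ge0 (a - b); have := sqr_ge0 (b - c); have := sqr_ge0 (c - a).
    by move: abc => /eqP; lra.
  by rewrite /c /midpoint_defect !mul0r subr0 => /eqP; rewrite subr_eq0 => /eqP.
move=> [//|m] _ /=; elim: m u hu => [|m IH] u hu; last first.
  rewrite energyS [RHS]energyS; congr (_ * _); apply: eq_bigr => i _; apply: IH.
  by have := poisson_rule_cell i hu; rewrite mul0r.
have [k ijk] : exists k, uniq [:: ord0; ord_max; k] by exact: third_index.
apply/esym/eqP; rewrite -subr_eq0 (energy1B _ ijk)/=.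
have E i j l : uniq [:: i; j; l] -> midpoint_defect u i j l = 0.
  by move=> ijl; rewrite /midpoint_defect (poisson_rule0 hu ijl) mul0r subr0 subrr.
by rewrite !E ?(uniq3_swap ijk) ?(uniq3_rot ijk)// subrr expr0n/= !addr0 !mulr0.
Qed.

End Rule.

(** * Existence of continuous solutions of the rule *)

Section Existence.
Variables (R : realType) (q : 'I_3 -> 'rV[R]_2) (K : set 'rV[R]_2).
Hypotheses (hq : equilateral q) (hK : is_gasket q K).
Implicit Types (x y z : 'rV[R]_2) (i j k l : 'I_3) (w : seq 'I_3) (m n : nat).
Implicit Types (a : 'I_3 -> R) (eta M : R).

Local Notation P := (contraction q).
Local Notation W := (word_map q).

(** A cell containing the point; at a junction either cell may be chosen. *)
Definition digit x : 'I_3 := xget ord0 [set i | K (2 *: x - q i)].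

Lemma digitP x : K x -> K (2 *: x - q (digit x)).
Proof.
move=> /(gasket_preimage hK)[i [y Ky xE]].
by apply: (@xgetPex _ ord0 [set j | K (2 *: x - q j)]);
  exists i; rewrite /= xE contractionK.
Qed.

Lemma digit_vertex i : digit (q i) = i.
Proof.
have := digitP (gasket_vertex hK i); move: (digit (q i)) => j Kj.
by have [] := contraction_eq_vertex hq hK Kj (expansionK _ _ _).
Qed.

(** The corner values of cell [i] given by the rule.  For the third index [k] the
    sum of all values turns [2 a_i + 2 a_j + a_k] into a form symmetric in
    [i, j] that does not mention [k]. *)
Definition subdivide a eta i : 'I_3 -> R :=
  fun j => if j == i then a i else 5^-1 * (\sum_l a l + a i + a j - eta / 3).

(** The corner value at the end of the first [n] digits; the next digit selects
    the corner, so that vertices get their exact value at every stage. *)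
Fixpoint approx n a eta x : R :=
  if n is n'.+1
  then approx n' (subdivide a eta (digit x)) (eta / 5) (2 *: x - q (digit x))
  else a (digit x).

(** The weight [1 / 6] on the source makes [spread_subdivide] hold with the
    contraction factor [3 / 5] of the harmonic case. *)
Definition spread_le a eta M := forall i j, a i - a j + `|eta| / 6 <= M.

Lemma spread_le_ex a eta : exists M, spread_le a eta M.
Proof.
exists (2 * \sum_i `|a i| + `|eta| / 6) => i j; rewrite lerD2r.
have le l : `|a l| <= \sum_i `|a i|.
  by rewrite (bigD1 l)//= lerDl sumr_ge0.
have := le i; have := le j; have := ler_norm (a i).
by have := ler_norm (- a j); rewrite normrN; lra.
Qed.

Lemma spread_ge0 a eta M : spread_le a eta M -> 0 <= M.
Proof. by move=> /(_ ord0 ord0); rewrite subrr add0r; apply: le_trans; rewrite divr_ge0.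
Qed.

Lemma spread_subdivide a eta M i :
  spread_le a eta M -> spread_le (subdivide a eta i) (eta / 5) (3 / 5 * M).
Proof.
move=> hM j l; rewrite normrM (ger0_norm (_ : 0 <= 5^-1)) ?invr_ge0// /subdivide.
have t1 := ler_norm eta; have t2 := ler_norm (- eta); rewrite normrN in t2.
have [jl|jl] := eqVneq j l.
  by rewrite jl subrr; have := hM i i; rewrite subrr; lra.
have [ji|ji] := eqVneq j i.
  have li : l != i by rewrite -ji eq_sym.
  have [k ijk] := third_index li; rewrite (negPf li) (sum_ord3 _ ijk).
  by have := hM i l; have := hM i k; lra.
have [k ijk] := third_index ji; rewrite (sum_ord3 _ ijk).
have [li|li] := eqVneq l i; first by have := hM j i; have := hM k i; lra.
by have := hM j l; have := spread_ge0 hM; lra.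
Qed.

Lemma subdivide_near a eta M i j l :
  spread_le a eta M -> `|subdivide a eta i j - a l| <= M.
Proof.
move=> hM; have t1 := ler_norm eta; have t2 := ler_norm (- eta); rewrite normrN in t2.
rewrite /subdivide ler_norml; have [_|ji] := eqVneq j i.
  by have := hM i l; have := hM l i; lra.
have [k ijk] := third_index ji; rewrite (sum_ord3 _ ijk).
have := hM i l; have := hM l i; have := hM j l; have := hM l j.
by have := hM k l; have := hM l k; lra.
Qed.

Lemma approx_near n a eta M x l :
  spread_le a eta M -> `|approx n a eta x - a l| <= 5 / 2 * M.
Proof.
elim: n a eta M x => [|n IH] a eta M x hM /=.
  have t := normr_ge0 eta; rewrite ler_norml.
  by have := hM (digit x) l; have := hM l (digit x); lra.
have := IH _ _ _ (2 *: x - q (digit x)) (spread_subdivide (digit x) hM).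
have := subdivide_near (digit x) l l hM.
set u := approx _ _ _ _; set b := subdivide _ _ _ _ => h1 h2.
by rewrite -(subrKA b) (le_trans (ler_normD _ _))//; lra.
Qed.

(** After [n] digits the spread has shrunk by [(3 / 5) ^+ n], and
    [approx_near] bounds all later changes by it. *)
Lemma approx_tail n m a eta M x : spread_le a eta M ->
  `|approx (n + m) a eta x - approx n a eta x| <= 5 / 2 * M * (3 / 5) ^+ n.
Proof.
elim: n a eta M x => [|n IH] a eta M x hM.
  by rewrite mulr1; exact: approx_near.
have := IH _ _ _ (2 *: x - q (digit x)) (spread_subdivide (digit x) hM).
by rewrite addSn /= exprS => /le_trans; apply; lra.
Qed.

Definition spline a eta x : R := lim (approx n a eta x @[n --> \oo]).

Lemma ratio_itv : 0 <= (3 / 5 : R) < 1.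
Proof. by apply/andP; split; lra. Qed.

Lemma is_cvg_approx a eta x : cvg (approx n a eta x @[n --> \oo]).
Proof.
have [M hM] := spread_le_ex a eta.
apply/cauchy_cvgP/cauchy_exP => e e0.
have [n hn] := geometric_small (5 / 2 * M) ratio_itv e0.
exists (approx n a eta x); exists n => // m /= nm.
rewrite -ball_normE /= distrC; apply: le_lt_trans hn.
by rewrite -(subnKC nm); exact: approx_tail.
Qed.

Lemma spline_near a eta M x l :
  spread_le a eta M -> `|spline a eta x - a l| <= 5 / 2 * M.
Proof.
move=> hM; have c := is_cvg_approx (a := a) (eta := eta) (x := x).
have c' : `|approx n a eta x - a l| @[n --> \oo] --> `|spline a eta x - a l|.
  by apply: cvg_norm; apply: cvgB; [exact: c|exact: cvg_cst].
rewrite -(cvg_lim _ c')//; apply: limr_le; first by apply/cvg_ex; eexists; exact: c'.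
by apply: nearW => n; exact: approx_near.
Qed.

Lemma spline_digit a eta x : spline a eta x =
  spline (subdivide a eta (digit x)) (eta / 5) (2 *: x - q (digit x)).
Proof.
rewrite {1}/spline; apply: cvg_lim => //; rewrite -cvg_shiftS.
exact: is_cvg_approx.
Qed.

Lemma spline_vertex a eta i : spline a eta (q i) = a i.
Proof.
rewrite /spline; apply: cvg_lim => //; suff E n : approx n a eta (q i) = a i.
  by under eq_fun do rewrite E; exact: cvg_cst.
elim: n a eta => [|n IH] a eta /=; rewrite digit_vertex//.
have -> : 2 *: q i - q i = q i.
  by rewrite -{1}(contraction_vertex q i) contractionK.
by rewrite IH /subdivide eqxx.
Qed.

Lemma subdivideC a eta i j : subdivide a eta i j = subdivide a eta j i.
Proof.
by rewrite /subdivide; have [->//|_] := eqVneq i j; rewrite [_ + a i + a j]addrAC.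
Qed.

(** For the chosen digit this is the definition.  If another cell contains the
    point too, the point is a junction, where both cells prescribe the value
    [subdivide a eta i j], symmetric in [i] and [j]. *)
Lemma spline_cell a eta i x : K x ->
  spline a eta (P i x) = spline (subdivide a eta i) (eta / 5) x.
Proof.
move=> Kx; rewrite spline_digit.
have := digitP (gasket_contraction hK i Kx); move: (digit _) => j Kj.
have [->|ij] := eqVneq i j; first by rewrite contractionK.
have [-> ->] := cell_meet hq hK ij Kx Kj (esym (expansionK _ _ _)).
by rewrite !spline_vertex subdivideC.
Qed.

Lemma spline_rule a eta : poisson_rule q eta (spline a eta).
Proof.
move=> w; elim: w a eta => [|l w IH] a eta i j k ijk /=; last first.
  rewrite !spline_cell; try exact: (gasket_word_map hK _ (gasket_vertex hK _)).
    by rewrite (IH _ _ _ _ _ ijk) exprS invfM !mulrA.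
  by apply: (gasket_word_map hK); apply: (gasket_contraction hK); exact: (gasket_vertex hK).
rewrite spline_cell; last exact: (gasket_vertex hK).
rewrite !spline_vertex /subdivide (sum_ord3 _ ijk).
have -> : j == i = false by move: ijk; rewrite uniq3E eq_sym => /and3P[/negPf ->].
by rewrite expr0; field.
Qed.

(** Near [x] there are only cells of level [n] that contain [x], and on each of
    them the oscillation is of order [(3 / 5) ^+ n]. *)
Lemma spline_modulus n a eta M x : spread_le a eta M -> K x ->
  \forall y \near x, K y ->
    `|spline a eta y - spline a eta x| <= 5 * M * (3 / 5) ^+ n.
Proof.
elim: n a eta M x => [|n IH] a eta M x hM Kx.
  apply: (@filterE _ (nbhs x)) => y _; rewrite mulr1 -(subrKA (a ord0)).
  rewrite (le_trans (ler_normD _ _))// [X in _ + X]distrC.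
  by have := spline_near x ord0 hM; have := spline_near y ord0 hM; lra.
have near_cell i : \forall y \near x, K (2 *: y - q i) ->
    `|spline a eta y - spline a eta x| <= 5 * M * (3 / 5) ^+ n.+1.
  have c : (fun y : 'rV[R]_2 => 2 *: y - q i) @ x --> 2 *: x - q i.
    exact: (cvgB (cvgZl_tmp cvg_id) (cvg_cst _)).
  have [Kz|nKz] := pselect (K (2 *: x - q i)).
    have := c _ (IH _ _ _ _ (spread_subdivide i hM) Kz).
    apply: (@filterS _ (nbhs x)) => y /= h /[dup] Ky /h.
    rewrite -!spline_cell// !expansionK => /le_trans; apply.
    by rewrite exprS; lra.
  have oK : nbhs (2 *: x - q i) (~` K).
    by apply: open_nbhs_nbhs; split => //; apply: closed_openC; exact: gasket_closed hK.
  by apply: (@filterS _ (nbhs x)) (c _ oK) => y.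
have := filter_forall (nbhs_filter x) near_cell.
apply: (@filterS _ (nbhs x)) => y h Ky; have [i [z Kz yE]] := gasket_preimage hK Ky.
by apply: (h i); rewrite yE contractionK.
Qed.

Lemma spline_continuous a eta : {within K, continuous (spline a eta)}.
Proof.
apply/subspace_continuousP => x Kx; apply/cvgrPdist_le => e e0.
have [M hM] := spread_le_ex a eta.
have [n hn] := geometric_small (5 * M) ratio_itv e0.
apply: filterS (spline_modulus n hM Kx) => y h Ky.
by rewrite distrC (le_trans (h Ky))// ltW.
Qed.

End Existence.

(** * The Dirichlet problem and interpolation functions *)

Section Dirichlet.
Variables (R : realType) (q : 'I_3 -> 'rV[R]_2) (K : set 'rV[R]_2).
Hypotheses (hq : equilateral q) (hK : is_gasket q K).
Implicit Types (x y z : 'rV[R]_2) (i j k l : 'I_3) (w : seq 'I_3) (m n : nat).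
Implicit Types (a : 'I_3 -> R) (eta : R) (f g d : 'rV[R]_2 -> R).

Local Notation P := (contraction q).
Local Notation W := (word_map q).

(** At a maximum the graph Laplacian is not positive, so the maximum is attained
    on the boundary. *)
Lemma maximum_principle m f :
  (forall x, (vertices q m `\` vertices q 0) x -> 0 < graph_laplacian q m f x) ->
  (forall i, f (q i) <= 0) -> forall x, vertices q m x -> f x <= 0.
Proof.
move=> sub bd x /verticesP[w [i [sw ->]]].
pose F (p : m.-tuple 'I_3 * 'I_3) := f (W p.1 (q p.2)).
pose p0 : m.-tuple 'I_3 * 'I_3 := (tcast sw (in_tuple w), i).
have E : f (W w (q i)) = F p0 by rewrite /F /= val_tcast.
rewrite {}E; have [p _ pmax] := arg_maxP F (isT : predT p0).
apply: le_trans (pmax p0 isT) _; rewrite /F; set y := W _ _.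
have Fy z : vertices q m z -> f z <= f y.
  move=> /verticesP[v [j [sv ->]]].
  have := pmax (tcast sv (in_tuple v), j) isT.
  by rewrite /F /= val_tcast.
have vy : vertices q m y.
  by apply/verticesP; exists p.1, p.2; rewrite size_tuple.
have [|ny] := pselect (vertices q 0 y); first by rewrite vertices0 => -[j _ <-].
have := sub y (conj vy ny); rewrite ltNge => /negP[].
apply: fsumr_le0 => z /= /adjacent_vertices[vz _].
by rewrite subr_le0 Fy.
Qed.

Lemma vertices_mono m n : (m <= n)%N -> vertices q m `<=` vertices q n.
Proof.
move=> /subnKC <-; elim: (n - m)%N => [|p IH]; first by rewrite addn0.
move=> x /IH /verticesP[w [i [sw ->]]]; apply/verticesP; exists (rcons w i), i.
by rewrite size_rcons sw addnS word_map_rcons contraction_vertex.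
Qed.

(** Adding [e] times the spline with source 1 makes the Laplacian of [d]
    positive on a fine enough graph, at a cost bounded by a multiple of [e]. *)
Lemma laplacian_vanish_le0 d :
  (forall i, d (q i) = 0) ->
  (forall e, 0 < e -> \forall m \near \oo, forall x,
     (vertices q m `\` vertices q 0) x ->
     `|3 / 2 * 5 ^+ m * graph_laplacian q m d x| < e) ->
  forall w i, d (W w (q i)) <= 0.
Proof.
move=> d0 dl w i.
(* The spline with source 1 and zero boundary values; it is bounded. *)
pose p := spline q K (fun=> 0) 1.
have p1 : poisson_rule q 1 p by exact: spline_rule.
have [M hM] := spread_le_ex (fun=> 0 : R) 1.
have M0 := spread_ge0 hM.
have pM x : `|p x| <= 5 / 2 * M by rewrite -[p x]subr0; exact: (spline_near q K x ord0 hM).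
apply/ler_addgt0Pr => e' e'0; rewrite add0r.
(* The added 1 only keeps the denominator positive. *)
pose e := e' / (5 / 2 * M + 1).
have D0 : 0 < 5 / 2 * M + 1 by lra.
have e0 : 0 < e by rewrite divr_gt0.
have [N _ hN] := dl e e0.
pose m := maxn N (size w).
have vx : vertices q m (W w (q i)).
  by apply: (@vertices_mono (size w)); [exact: leq_maxr|apply/verticesP; exists w, i].
have := @maximum_principle m (fun x => 1 * d x + e * p x) _ _ _ vx.
rewrite mul1r => main.
have : d (W w (q i)) + e * p (W w (q i)) <= 0.
  apply: main => // [x xV|j].
    rewrite graph_laplacian_lin (poisson_rule_graph_laplacian hq hK p1 xV) mul1r.
    have c0 : 0 < 3 / 2 * 5 ^+ m :> R by rewrite mulr_gt0// exprn_gt0.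
    have := hN m (leq_maxl _ _) x xV; rewrite ltr_norml => /andP[+ _].
    rewrite -(pmulr_rgt0 _ c0) mulrDr => h.
    have -> : 3 / 2 * 5 ^+ m * (e * (2 / 3 * 1 * 5^-1 ^+ m)) = e.
      by rewrite exprVn; field; rewrite expf_neq0// pnatr_eq0.
    by rewrite addrC -ltrBlDl sub0r.
  by rewrite d0 /p (spline_vertex hq hK) !mulr0 addr0.
move=> h; have := pM (W w (q i)); rewrite ler_norml => /andP[pl _].
have : e * (- (5 / 2 * M)) <= e * p (W w (q i)) by rewrite ler_pM2l.
have : e * (5 / 2 * M + 1) = e' by rewrite /e mulfVK// gt_eqF.
by lra.
Qed.

Lemma dirichlet_spline a eta : dirichlet_solution q K a eta (spline q K a eta).
Proof.
split; first by move=> i; exact: spline_vertex.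
split; [exact: spline_continuous|exact/continuous_subspaceT/cst_continuous|].
move=> e e0; apply: nearW => m x vx.
rewrite (poisson_rule_graph_laplacian hq hK (spline_rule hq hK a eta) vx).
have -> : 3 / 2 * 5 ^+ m * (2 / 3 * eta * 5^-1 ^+ m) - eta = 0.
  by rewrite exprVn; field; rewrite expf_neq0// pnatr_eq0.
by rewrite normr0.
Qed.

Lemma dirichlet_le a eta u v :
  dirichlet_solution q K a eta u -> dirichlet_solution q K a eta v ->
  forall w i, u (W w (q i)) <= v (W w (q i)).
Proof.
move=> [ub [_ _ ul]] [vb [_ _ vl]] w i.
rewrite -subr_le0.
have := @laplacian_vanish_le0 (fun x => 1 * u x + (-1) * v x) _ _ w i.
rewrite mul1r mulN1r; apply.
  by move=> j; rewrite ub vb mul1r mulN1r subrr.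
move=> e e0; have e20 : 0 < e / 2 by rewrite divr_gt0.
apply: filterS2 (ul _ e20) (vl _ e20) => m hu hv x vx.
rewrite graph_laplacian_lin.
have := hu x vx; have := hv x vx; rewrite !ltr_norml => /andP[? ?] /andP[? ?].
by apply/andP; split; lra.
Qed.

Lemma dirichlet_unique a eta u v :
  dirichlet_solution q K a eta u -> dirichlet_solution q K a eta v ->
  forall x, K x -> u x = v x.
Proof.
move=> hu hv; apply: (eq_on_gasket hK); [by case: hu => _ []|by case: hv => _ []|].
by move=> w i; apply/eqP; rewrite eq_le !(dirichlet_le hu hv, dirichlet_le hv hu).
Qed.

(** Induction on the word: on a subcell, [f] is [1 / 5] of itself on a larger
    cell plus a harmonic function, so the source is divided by 5. *)
Lemma FIF_poisson_rule a eta f :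
  is_FIF q K (1 / 5) f -> interpolation_values q a eta f -> poisson_rule q eta f.
Proof.
move=> [_ _ [h [hh fh]]] [fq fq1] w; elim: w => [|l w IH] i j k ijk.
  by rewrite /= (fq1 _ _ _ ijk) !fq expr0 divr1.
have Kw v b : K (W v (q b)) by exact: (gasket_word_map hK _ (gasket_vertex hK _)).
have Kp : K (W w (P i (q j))) by rewrite -word_map_rcons; exact: Kw.
rewrite /= !fh// (IH _ _ _ ijk).
rewrite (proj1 (harmonicP hq hK (h l)) (hh l) w _ _ _ ijk) exprS invfM; field.
by rewrite expf_neq0// pnatr_eq0.
Qed.

(** The sources [eta / 5] of [f] on a cell and [eta / 5] of [f / 5] cancel. *)
Lemma poisson_rule_FIF eta f :
  {within K, continuous f} -> poisson_rule q eta f -> is_FIF q K (1 / 5) f.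
Proof.
move=> cf hf; split => //; first by apply/andP; split; lra.
exists (fun i x => 1 * f (P i x) + (- (1 / 5)) * f x); split=> [i|i x _]; last by ring.
apply/(harmonicP hq hK).
have := poisson_rule_lin 1 (- (1 / 5)) (poisson_rule_cell i hf) hf.
by have -> : 1 * (eta / 5) + - (1 / 5) * eta = 0 by field.
Qed.

Lemma spline_interpolation a eta : interpolation_values q a eta (spline q K a eta).
Proof.
split=> [i|i j k ijk]; first exact: spline_vertex.
by rewrite (poisson_rule0 (spline_rule hq hK a eta) ijk) !(spline_vertex hq hK).
Qed.

End Dirichlet.

Theorem corollary3p8 (R : realType) (q : 'I_3 -> 'rV[R]_2) (K : set 'rV[R]_2)
    (hq : equilateral q) (hK : is_gasket q K) (a : 'I_3 -> R) (eta : R) :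
  exists u : 'rV[R]_2 -> R,
    [/\ dirichlet_solution q K a eta u,
        (forall v : 'rV[R]_2 -> R, dirichlet_solution q K a eta v ->
           forall x, K x -> v x = u x),
        is_FIF q K (1 / 5) u,
        interpolation_values q a eta u &
        (forall f : 'rV[R]_2 -> R, is_FIF q K (1 / 5) f ->
           interpolation_values q a eta f -> forall x, K x -> f x = u x)].
Proof.
have uD := dirichlet_spline hq hK a eta.
have uR := spline_rule hq hK a eta.
have uC := @spline_continuous _ q K hq hK a eta.
exists (spline q K a eta); split => //.
- by move=> v /(dirichlet_unique hq hK) /(_ uD).
- exact: poisson_rule_FIF uC uR.
- exact: spline_interpolation.
move=> f fF fI; have [_ fC _] := fF.
apply: (eq_on_gasket hK fC uC); apply: (poisson_rule_unique _ uR).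
  exact: (FIF_poisson_rule hq hK fF fI).
by move=> i; rewrite (spline_vertex hq hK); case: fI.
Qed.
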